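(* Let $0=t_0<t_1<\cdots<t_N=T$ be any time grid with $\tau_k=t_k-t_{k-1}$, $\tau=\max_{1\le k\le N}\tau_k$, and let $f$ be Lipschitz continuous with Lipschitz constant $L_f>0$. Let $v^n$ and $\bar v^n$ satisfy the variable-step BDF2 scheme and the perturbed BDF2 scheme, respectively, $$D_2v^n=f(t_n,v^n),\qquad D_2\bar v^n=f(t_n,\bar v^n)+\varepsilon^n\qquad\text{for }2\le n\le N,$$ with a bounded sequence $\{\varepsilon^n\}$, so that $\tilde v^n:=\bar v^n-v^n$ solves $$D_2\tilde v^i=f(t_i,\bar v^i)-f(t_i,v^i)+\varepsilon^i\qquad\text{for }2\le i\le N.$$ If $\tau\le 1/(4L_f)$, then $$|\tilde v^{n}|\le 2\exp(4L_ft_{n-1})\Big(|\tilde v^{1}|+2\tau\,|\partial_\tau\tilde v^{1}|+2t_n\max_{2\le i\le n}|\varepsilon^i|\Big)\qquad\text{for }2\le n\le N.$$ Thus the variable-step BDF2 scheme is stable on arbitrary time meshes.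
   Context: The scheme approximates the initial value problem $dv/dt=f(t,v)$ for $0<t\le T$. The function $f(t,v)$ is Lipschitz continuous in $v$ with constant $L_f$: $|f(t,v)-f(t,w)|\le L_f|v-w|$. Step ratios: $r_k:=\tau_k/\tau_{k-1}$ for $2\le k\le N$. For a sequence $\{v^n\}_{n=0}^N$, $\partial_\tau v^n:=(v^n-v^{n-1})/\tau_n$. The variable-step BDF2 formula is $$D_2v^n:=\frac{1+2r_n}{1+r_n}\,\partial_\tau v^n-\frac{r_n}{1+r_n}\,\partial_\tau v^{n-1}\qquad\text{for }n\ge 2.$$ The starting values ($n=0,1$) of $v^n$ and $\bar v^n$ are assumed given. Definition of stability (of a $k$-step scheme $D_kv^n=f(t_n,v^n)$, $k\le n\le N$, with unequal time-steps, here $k=2$): assuming $f$ is Lipschitz continuous with constant $L_f>0$, the scheme is stable (on the class of grids considered) if there exist a real number $\tau_0>0$ and a fixed constant $C$ (independent of the step sizes $\tau_n$) such that the solution of the difference equation $D_k\tilde v^i=f(t_i,\bar v^i)-f(t_i,v^i)+\varepsilon^i$, $k\le i\le N$, fulfills $$\max_{k\le n\le N}|\tilde v^{n}|\le C\Big(\sum_{i=0}^{k-1}|\tilde v^i|+\tau\sum_{i=1}^{k-1}|\partial_\tau\tilde v^i|+\max_{k\le i\le N}|\varepsilon^i|\Big)\qquad\text{whenever all }\tau_n\le\tau_0.$$ *)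

(* Defs.v *)
From HB Require Import structures.
From mathcomp Require Import all_boot all_order all_algebra.
From mathcomp Require Import reals.

Set Implicit Arguments.
Unset Strict Implicit.
Unset Printing Implicit Defensive.

Import Order.TTheory GRing.Theory Num.Theory.

Local Open Scope ring_scope.

(* A grid t_0 < ... < t_N and a grid sequence v^0, ..., v^N are functions     *)
(* nat -> R, of which only the values at 0, ..., N are ever used.             *)

Definition is_grid (R : realType) (T : R) (N : nat) (t : nat -> R) : Prop :=
  [/\ t 0%N = 0, t N = T & forall k, (1 <= k <= N)%N -> t k.-1 < t k].

Definition step (R : realType) (t : nat -> R) (k : nat) : R := t k - t k.-1.

(* The default value 0 of the iterated maxima, here and below, is harmless:   *)
(* all the terms are nonnegative.                                             *)
Definition max_step (R : realType) (N : nat) (t : nat -> R) : R :=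
  \big[Num.max/0]_(1 <= k < N.+1) step t k.

(* Meaningful for 2 <= k. *)
Definition step_ratio (R : realType) (t : nat -> R) (k : nat) : R :=
  step t k / step t k.-1.

(* Meaningful for 1 <= n. *)
Definition dtau (R : realType) (t v : nat -> R) (n : nat) : R :=
  (v n - v n.-1) / step t n.

(* Meaningful for 2 <= n. *)
Definition bdf2 (R : realType) (t v : nat -> R) (n : nat) : R :=
  let r := step_ratio t n in
  (1 + 2 * r) / (1 + r) * dtau t v n - r / (1 + r) * dtau t v n.-1.

Definition lipschitz_in_v (R : realType) (f : R -> R -> R) (T L : R) : Prop :=
  forall s x y : R, 0 < s <= T -> `|f s x - f s y| <= L * `|x - y|.

(* Stability, on the grids of [0, T] lying in the class G, of the k-step      *)
(* scheme D v^n = f(t_n, v^n), k <= n <= N; the operator D takes the grid,    *)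
(* the sequence and the index n. The constants tau0 and C may depend on f     *)
(* (hence on its Lipschitz constant) and T, but not on the grid nor on the    *)
(* sequences. That f is Lipschitz is a separate hypothesis (lipschitz_in_v).  *)
Definition stable (R : realType) (k : nat)
    (D : (nat -> R) -> (nat -> R) -> nat -> R) (f : R -> R -> R) (T : R)
    (G : nat -> (nat -> R) -> Prop) : Prop :=
  exists tau0 C : R, 0 < tau0 /\
  forall (N : nat) (t : nat -> R), (k <= N)%N -> is_grid T N t -> G N t ->
  (forall n, (1 <= n <= N)%N -> step t n <= tau0) ->
  forall v vbar eps : nat -> R,
  let vt := fun i => vbar i - v i in
  (forall i, (k <= i <= N)%N ->
     D t vt i = f (t i) (vbar i) - f (t i) (v i) + eps i) ->
  \big[Num.max/0]_(k <= n < N.+1) `|vt n| <=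
    C * (\sum_(0 <= i < k) `|vt i|
         + max_step N t * (\sum_(1 <= i < k) `|dtau t vt i|)
         + \big[Num.max/0]_(k <= i < N.+1) `|eps i|).

(* Main.v *)
Require Import Defs.
From HB Require Import structures.
From mathcomp Require Import all_boot all_order all_algebra.
From mathcomp Require Import reals sequences exp.
From mathcomp Require Import ring lra zify.

Set Implicit Arguments.
Unset Strict Implicit.
Unset Printing Implicit Defensive.

Import Order.TTheory GRing.Theory Num.Theory.

Local Open Scope ring_scope.

(* Solving D_2 v^n = g^n for w_n = dtau v^n gives the convex combination      *)
(* w_n = q_n w_(n-1) + (1 - q_n) g^n with q_n = r_n / (1 + 2 r_n) < 1/2,      *)
(* whatever the step ratio r_n > 0. With |g^n| <= L |v^n| + E and the         *)
(* nondecreasing majorant S_n = |v^1| + sum_(2 <= k <= n) tau_k |w_k| of      *)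
(* |v^n|, induction gives |w_n| <= 2^(1-n) |w_1| + L S_n + E. Hence           *)
(* P_n = S_n + tau 2^(1-n) |w_1| satisfies                                    *)
(* (1 - L tau_n) P_n <= P_(n-1) + tau_n E, and the discrete Gronwall          *)
(* argument concludes.                                                        *)

(** The scheme is read as a recursion for the difference quotients, not for the values. By
    [dtau_le_convex] each quotient is bounded by an average in which its predecessor weighs at most
    1/2, whatever the step ratio; this is why no ratio bound enters. The influence of the starting
    quotient thus halves at every step, and its total effect on the values is a geometric series of
    size [tau] times [|dtau t v 1|], even on wild grids. What remains is an implicit one-step
    inequality, settled by Gronwall in [bdf2_estimate]. The Lipschitz bound on [f] feeds the error
    into it ([bdf2_perturbation_estimate]), and [t n <= T] then makes the constants uniform
    ([bdf2_stable]). *)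

Lemma expR_ge1 (R : realType) (x : R) : 0 <= x -> 1 <= expR x.
Proof. by move=> x_ge0; rewrite (le_trans _ (expR_ge1Dx _))// lerDl. Qed.

(** * Positivity and monotonicity on a grid *)

Section Grid.
Context (R : realType) (T : R) (N : nat) (t : nat -> R).
Hypothesis grid_t : is_grid T N t.

Lemma grid_step_gt0 k : (1 <= k <= N)%N -> 0 < step t k.
Proof. by case: grid_t => _ _ lt_t kN; rewrite subr_gt0 lt_t. Qed.

Lemma grid_le m n : (m <= n <= N)%N -> t m <= t n.
Proof.
elim: n => [|n IHn]; first by rewrite leqn0 => /andP[/eqP->].
rewrite leq_eqVlt => /andP[/predU1P[->//|mn] nN].
apply: le_trans (IHn _) _; first by rewrite -ltnS mn ltnW.
by rewrite -subr_ge0; apply/ltW/(@grid_step_gt0 n.+1).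
Qed.

Lemma grid_ge0 n : (n <= N)%N -> 0 <= t n.
Proof. by case: (grid_t) => <- _ _ nN; apply: grid_le. Qed.

Lemma grid_le_end n : (n <= N)%N -> t n <= T.
Proof. by case: (grid_t) => _ <- _ nN; apply: grid_le; rewrite nN leqnn. Qed.

Lemma grid_gt0 n : (1 <= n <= N)%N -> 0 < t n.
Proof.
move=> /andP[n_gt0 nN]; case: (grid_t) => _ _ lt_t.
apply: (@le_lt_trans _ _ (t n.-1)); last by rewrite lt_t ?n_gt0.
by apply: grid_ge0; lia.
Qed.

End Grid.

Lemma step_le_max_step (R : realType) (N : nat) (t : nat -> R) k :
  (1 <= k <= N)%N -> step t k <= max_step N t.
Proof. by move=> kN; apply: le_bigmax_seq; rewrite ?mem_index_iota. Qed.

Lemma bdf2B (R : realType) (t v w : nat -> R) n :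
  bdf2 t (fun i => w i - v i) n = bdf2 t w n - bdf2 t v n.
Proof. by rewrite /bdf2 /dtau /=; ring. Qed.

Lemma dtau_le_convex (R : realType) (t v : nat -> R) n :
  0 < step t n -> 0 < step t n.-1 ->
  exists2 q : R, 0 <= q <= 1 / 2 &
    `|dtau t v n| <= q * `|dtau t v n.-1| + (1 - q) * `|bdf2 t v n|.
Proof.
move=> sn sn1; have r_gt0 : 0 < step_ratio t n by rewrite divr_gt0.
rewrite /bdf2; move: (step_ratio t n) r_gt0 (dtau t v n) (dtau t v n.-1).
move=> r r_gt0 w w'.
have d_gt0 : 0 < 1 + 2 * r by lra.
have q01 : 0 <= r / (1 + 2 * r) <= 1 / 2.
  by apply/andP; split; [rewrite divr_ge0// ltW|rewrite ler_pdivrMr//; lra].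
(* Solving for [w] puts weight r / (1 + 2r) on the previous quotient and (1 + r) / (1 + 2r) on
   [bdf2]. *)
exists (r / (1 + 2 * r)) => //.
set q := r / _ in q01 *; set g := _ * w - _ * w'.
have {1}-> : w = q * w' + (1 - q) * g.
  rewrite /q /g; field.
  by apply/andP; split; apply: lt0r_neq0; lra.
clearbody q g; apply: le_trans (ler_normD _ _) _.
by rewrite !normrM (ger0_norm (x := q)) ?(ger0_norm (x := 1 - q)); lra.
Qed.

(** * A priori bound up to a fixed index [n], with [f] entering only through linear growth *)

Section Estimate.
Context (R : realType) (T : R) (N : nat) (t v : nat -> R) (L E tau : R).
Context (n : nat).
Hypotheses (grid_t : is_grid T N t) (nN : (n <= N)%N).
Hypotheses (L_ge0 : 0 <= L) (E_ge0 : 0 <= E).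
Hypothesis step_le : forall k, (1 <= k <= n)%N -> step t k <= tau.
Hypothesis bdf2_le :
  forall i, (2 <= i <= n)%N -> `|bdf2 t v i| <= L * `|v i| + E.

Definition increment_majorant m :=
  `|v 1%N| + \sum_(1 <= k < m) step t k.+1 * `|dtau t v k.+1|.
Local Notation S := increment_majorant.

Let SS m : (0 < m)%N -> S m.+1 = S m + step t m.+1 * `|dtau t v m.+1|.
Proof. by move=> m_gt0; rewrite /increment_majorant big_nat_recr//= addrA. Qed.

Let norm_le_S m : (m < n)%N -> `|v m.+1| <= S m.+1.
Proof.
elim: m => [|m IHm] mn; first by rewrite /increment_majorant big_geq// addr0.
have st : 0 < step t m.+2 by apply: (grid_step_gt0 grid_t); lia.
rewrite SS//; apply: le_trans (lerD (IHm (ltnW mn)) (lexx _)).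
rewrite /dtau/= normrM normfV (gtr0_norm st) mulrC divfK ?lt0r_neq0//.
by rewrite -lerBlDl (le_trans _ (lerB_dist _ _))//.
Qed.

(** Averaging keeps the bound because [S] is nondecreasing: the older value of [S] may be replaced
    by the newer one, and only the initial term picks up the factor [q <= 1/2]. *)
Let dtau_le m : (m < n)%N ->
  `|dtau t v m.+1| <= 2^-1 ^+ m * `|dtau t v 1| + L * S m.+1 + E.
Proof.
elim: m => [|m IHm] mn.
  have S_ge0 := le_trans (normr_ge0 _) (norm_le_S mn).
  by rewrite expr0 mul1r -addrA lerDl addr_ge0// mulr_ge0.
have st : 0 < step t m.+2 by apply: (grid_step_gt0 grid_t); lia.
have st' : 0 < step t m.+1 by apply: (grid_step_gt0 grid_t); lia.
have [q /andP[q_ge0 q_le]] := dtau_le_convex v (n := m.+2) st st'.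
move=> /le_trans-> //=.
have LSS : L * S m.+1 <= L * S m.+2.
  by rewrite ler_wpM2l// (@SS m.+1)// lerDl mulr_ge0// ltW.
have := bdf2_le (i := m.+2) mn.
have := ler_wpM2l L_ge0 (norm_le_S mn).
move=> Lv gle.
have {}gle : `|bdf2 t v m.+2| <= L * S m.+2 + E by lra.
have q1 : 0 <= 1 - q by lra.
have h1 := ler_wpM2l q1 gle.
have h2 := ler_wpM2l q_ge0 (IHm (ltnW mn)).
have h3 := ler_wpM2l q_ge0 LSS.
have z_ge0 : 0 <= 2^-1 ^+ m * `|dtau t v 1|.
  by rewrite mulr_ge0// exprn_ge0// invr_ge0.
have h4 := ler_wpM2r z_ge0 q_le.
rewrite exprS -mulrA.
move: (2^-1 ^+ m * `|dtau t v 1|) h2 h4 {z_ge0} => z h2 h4.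
lra.
Qed.

(** The extra term is a reserve: it drops by tau 2^(-m) [|dtau t v 1|] from [m] to [m.+1] (for
    positive [m]), which pays for the decaying term of [dtau_le]. *)
Definition gronwall_majorant m := S m + tau * (2^-1 ^+ m.-1 * `|dtau t v 1|).
Local Notation P := gronwall_majorant.

Let P_rec m : (0 < m < n)%N ->
  (1 - L * step t m.+1) * P m.+1 <= P m + step t m.+1 * E.
Proof.
case: m => // m /andP[_ mn].
have st : 0 < step t m.+2 by apply: (grid_step_gt0 grid_t); lia.
have st_le : step t m.+2 <= tau by apply: step_le.
rewrite /gronwall_majorant/= SS// exprS -mulrA.
have := ler_wpM2l (ltW st) (dtau_le mn).
rewrite SS// exprS -mulrA.
have z_ge0 : 0 <= 2^-1 ^+ m * `|dtau t v 1|.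
  by rewrite mulr_ge0// exprn_ge0// invr_ge0.
move: (2^-1 ^+ m * _) z_ge0 => z z_ge0 h1.
have h2 := ler_wpM2r z_ge0 st_le.
(* Allows [S] to be replaced by the larger [P] in the implicit term. *)
have h3 : 0 <= L * step t m.+2 * (tau * z).
  by rewrite !mulr_ge0// ?ltW// (lt_le_trans st).
lra.
Qed.

Hypothesis Ltau_le : L * tau <= 1 / 4.

Let Lstep m : (m < n)%N -> 0 <= L * step t m.+1 <= 1 / 4.
Proof.
move=> mn; apply/andP; split; last first.
  by rewrite (le_trans _ Ltau_le)// ler_wpM2l// step_le.
by rewrite mulr_ge0// ltW// (grid_step_gt0 grid_t)// (leq_trans mn).
Qed.

Let P1_ge0 : (0 < n)%N -> 0 <= P 1.
Proof.
move=> n_gt0; rewrite /gronwall_majorant /increment_majorant big_geq//.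
rewrite expr0 mul1r addr0 addr_ge0// mulr_ge0//.
rewrite (le_trans _ (@step_le 1%N _))// ltW// (grid_step_gt0 grid_t)//.
exact: leq_trans nN.
Qed.

Let gronwall m : (m < n)%N ->
  P m.+1 <= expR (2 * L * t m.+1) * (P 1 + t m.+1 * E).
Proof.
elim: m => [|m IHm] mn.
  have t1 : 0 <= t 1%N by apply: (grid_ge0 grid_t); lia.
  rewrite -[leLHS]mul1r ler_pM ?P1_ge0//.
    by rewrite expR_ge1// !mulr_ge0.
  by rewrite lerDl mulr_ge0.
have st : 0 < step t m.+2 by apply: (grid_step_gt0 grid_t); lia.
have t1 : 0 <= t m.+1 by apply: (grid_ge0 grid_t); lia.
have P1 : 0 <= P 1 by apply: P1_ge0; lia.
have /andP[x0 x4] := Lstep mn.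
have -> : t m.+2 = t m.+1 + step t m.+2 by rewrite /step /=; ring.
have := IHm (ltnW mn); have := P_rec (m := m.+1) mn.
move: (step t m.+2) (t m.+1) (P m.+2) (P m.+1) (P 1%N) st t1 P1 x0 x4.
move=> s u p p' p1 s_gt0 u_ge0 p1_ge0 x0 x4 Hrec IH.
have e1 : 1 <= expR (2 * L * u) by rewrite expR_ge1// !mulr_ge0.
have sE : 0 <= s * E by rewrite mulr_ge0// ltW.
(* The exponential is at least 1, so the new forcing [s * E] fits inside the bracket. *)
have h : p' + s * E <= expR (2 * L * u) * (p1 + (u + s) * E).
  have := ler_wpM2r sE e1; lra.
have b0 : 0 <= expR (2 * L * u) * (p1 + (u + s) * E).
  by rewrite mulr_ge0 ?expR_ge0// addr_ge0// mulr_ge0// addr_ge0// ltW.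
rewrite [_ * (u + s)]mulrDr expRD mulrAC.
have e2 : 1 + 2 * L * s <= expR (2 * L * s) by apply: expR_ge1Dx.
have x1 : 0 < 1 - L * s by lra.
(* (1 - x)(1 + 2 x) = 1 + x (1 - 2 x) >= 1 for 0 <= x <= 1/2 *)
have e3 : 1 <= (1 - L * s) * expR (2 * L * s).
  apply: le_trans (ler_wpM2l (ltW x1) e2); rewrite -mulrA; nra.
rewrite -(ler_pM2l x1) (le_trans Hrec)// (le_trans h)//.
move: (expR (2 * L * u) * _) b0 => b b0.
rewrite [b * _]mulrC mulrA.
by rewrite -[leLHS]mul1r ler_wpM2r.
Qed.

Lemma bdf2_estimate : (2 <= n)%N ->
  `|v n| <= 2 * expR (4 * L * t n.-1) *
     (`|v 1%N| + 2 * tau * `|dtau t v 1| + 2 * t n * E).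
Proof.
(* The section facts are generalized along with [n] so that they follow it to [m.+2]. *)
case: n nN norm_le_S P_rec Lstep P1_ge0 gronwall step_le => [//|[//|m]].
move=> mN HS Hrec HL HP1 Hgr Hst _.
have st : 0 < step t m.+2 by apply: (grid_step_gt0 grid_t); lia.
have t1 : 0 <= t m.+1 by apply: (grid_ge0 grid_t); lia.
have P1 : 0 <= P 1 by apply: HP1.
have tau_gt0 : 0 < tau by apply: lt_le_trans st (Hst _ _); lia.
have z_ge0 : 0 <= tau * (2^-1 ^+ m.+1 * `|dtau t v 1|).
  by rewrite !mulr_ge0 ?exprn_ge0 ?invr_ge0// ltW.
have vP : `|v m.+2| <= P m.+2.
  by rewrite (le_trans (HS _ (ltnSn _)))// /gronwall_majorant lerDl.
have /andP[x0 x4] := HL m.+1 (ltnSn _).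
have := Hrec m.+1; rewrite ltnSn => /(_ isT) Pr.
have := Hgr m (ltnW (ltnSn _)) => Gr.
have P1E : P 1 = `|v 1%N| + tau * `|dtau t v 1|.
  by rewrite /gronwall_majorant /increment_majorant big_geq// expr0 mul1r addr0.
have tw : 0 <= tau * `|dtau t v 1| by rewrite mulr_ge0// ltW.
apply: (le_trans vP).
(* The last step is not put in the exponential: 1 - L [step] is at least 1/2, which yields the
   leading factor 2 and leaves the exponent at [t n.-1]. *)
have P2 : P m.+2 <= 2 * (P m.+1 + step t m.+2 * E).
  have : 0 <= P m.+2 by apply: le_trans vP.
  nra.
apply: (le_trans P2); rewrite -mulrA ler_wpM2l//=.
have tE : t m.+2 = t m.+1 + step t m.+2 by rewrite /step /=; ring.
have sE : 0 <= step t m.+2 * E by rewrite mulr_ge0// ltW.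
have uE : 0 <= t m.+1 * E by rewrite mulr_ge0.
have e1 : 1 <= expR (2 * L * t m.+1) by rewrite expR_ge1// !mulr_ge0.
have h : P m.+1 + step t m.+2 * E <=
    expR (2 * L * t m.+1) * (P 1 + t m.+2 * E).
  have := ler_wpM2r sE e1; rewrite tE; lra.
(* The stated constants are reached with slack: 2L becomes 4L, and the weights of [tau] and [t n]
   are doubled. *)
apply: (le_trans h); apply: ler_pM; rewrite ?expR_ge0//.
- by rewrite tE mulrDl; apply: addr_ge0 => //; apply: addr_ge0.
- by rewrite ler_expR -!mulrA ler_wpM2r ?mulr_ge0// ler_nat.
- rewrite P1E tE; lra.
Qed.

End Estimate.

(** * From linear growth back to the scheme and its stability *)

Lemma bdf2_perturbation_estimate (R : realType) (f : R -> R -> R) (T L : R)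
    (N : nat) (t v vbar eps : nat -> R) (tau : R) :
  let vt := fun i => vbar i - v i in
  0 <= L -> lipschitz_in_v f T L -> is_grid T N t ->
  (forall k, (1 <= k <= N)%N -> step t k <= tau) -> L * tau <= 1 / 4 ->
  (forall i, (2 <= i <= N)%N ->
     bdf2 t vt i = f (t i) (vbar i) - f (t i) (v i) + eps i) ->
  forall n, (2 <= n <= N)%N ->
    `|vt n| <= 2 * expR (4 * L * t n.-1) *
      (`|vt 1%N| + 2 * tau * `|dtau t vt 1|
       + 2 * t n * \big[Num.max/0]_(2 <= i < n.+1) `|eps i|).
Proof.
move=> vt L_ge0 hf grid_t tauP Ltau vtP n /andP[n2 nN].
apply: (bdf2_estimate grid_t nN) => //.
- by apply: bigmax_ge_id.
- by move=> k /andP[k1 kn]; rewrite tauP// k1 (leq_trans kn).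
- move=> i /andP[i2 iN]; have iN' := leq_trans iN nN.
  rewrite vtP ?i2// (le_trans (ler_normD _ _))// lerD//.
    by rewrite hf// (grid_gt0 grid_t) ?(grid_le_end grid_t)// (ltnW i2).
  apply: (le_bigmax_seq 0 i xpredT (fun j => `|eps j|)) => //.
  by rewrite mem_index_iota i2.
Qed.

Lemma bdf2_stable (R : realType) (f : R -> R -> R) (T L : R) :
  0 < T -> 0 < L -> lipschitz_in_v f T L ->
  stable 2 (@bdf2 R) f T (fun _ _ => True).
Proof.
move=> T_gt0 L_gt0 hf.
(* The factor 2 + 2T dominates the coefficients 1, 2 and 2T of the three terms of the estimate. *)
exists (1 / (4 * L)), (2 * expR (4 * L * T) * (2 + 2 * T)).
split; first by rewrite divr_gt0// mulr_gt0.
move=> N t N2 grid_t _ step_le v vbar eps vt vtP.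
have tau_le : max_step N t <= 1 / (4 * L).
  rewrite /max_step big_nat.
  by apply: bigmax_le => //; rewrite divr_ge0// mulr_ge0// ltW.
have tau_ge0 : 0 <= max_step N t by apply: bigmax_ge_id.
have Ltau : L * max_step N t <= 1 / 4.
  move: tau_le; rewrite invfM mul1r => /(ler_wpM2l (ltW L_gt0)).
  by rewrite mulrCA mulfV ?gt_eqF// mulr1 mul1r.
rewrite (big_nat1 _ _ (fun i => `|dtau t vt i|)).
rewrite (@big_nat_recl _ _ +%R 1)// (big_nat1 _ _ (fun i => `|vt i.+1|)).
set E := \big[_/_]_(_ <= i < _) `|eps i|.
have E_ge0 : 0 <= E by apply: bigmax_ge_id.
have tw : 0 <= max_step N t * `|dtau t vt 1| by rewrite mulr_ge0.
have v0 := normr_ge0 (vt 0%N); have v1 := normr_ge0 (vt 1%N).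
have C_ge0 : 0 <= 2 * expR (4 * L * T) by rewrite mulr_ge0 ?expR_ge0.
rewrite big_nat; apply: bigmax_le => [|n].
  by rewrite !mulr_ge0 ?expR_ge0 ?addr_ge0 ?mulr_ge0// ltW.
rewrite ltnS => /andP[n2 nN].
have := bdf2_perturbation_estimate (ltW L_gt0) hf grid_t
  (@step_le_max_step _ N t) Ltau vtP (n := n).
rewrite n2 nN -/vt -[vbar 1%N - v 1%N]/(vt 1%N) => /(_ isT)/le_trans; apply.
set En := \big[_/_]_(_ <= i < _) `|eps i|.
have t_ge0 := grid_ge0 grid_t nN; have t_le := grid_le_end grid_t nN.
have En_ge0 : 0 <= En by apply: bigmax_ge_id.
have EnE : En <= E.
  rewrite /En big_nat; apply: bigmax_le => // i; rewrite ltnS => /andP[i2 iN].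
  apply: (le_bigmax_seq 0 i xpredT (fun j => `|eps j|)) => //.
  by rewrite mem_index_iota i2 ltnS (leq_trans iN).
have tE : t n * En <= T * E by apply: ler_pM.
have tEn_ge0 : 0 <= t n * En by rewrite mulr_ge0.
have exp_le : expR (4 * L * t n.-1) <= expR (4 * L * T).
  have L4_ge0 : 0 <= 4 * L by lra.
  rewrite ler_expR (ler_wpM2l L4_ge0)// (grid_le_end grid_t)//.
  by rewrite (leq_trans _ nN)// leq_pred.
have exp_ge0 := expR_ge0 (4 * L * t n.-1).
(* The cross terms with [T] are products, so [lra] needs their sign given. *)
have Th := mulr_ge0 (ltW T_gt0) (addr_ge0 (addr_ge0 v0 v1) tw).
clearbody E En; rewrite -[leRHS]mulrA -[2 * _ * `|_|]mulrA -[2 * _ * En]mulrA.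
move: (max_step N t * _) (t n * En) tw tE tEn_ge0 Th => w e tw tE tEn_ge0 Th.
move: (expR _) (expR _) exp_le exp_ge0 C_ge0 => x y xy x_ge0 y_ge0.
move: `|vt 0%N| `|vt 1%N| v0 v1 Th => a b a_ge0 b_ge0 Th.
by apply: ler_pM; lra.
Qed.

Theorem theorem2p1 (R : realType) (f : R -> R -> R) (T Lf : R)
    (hT : 0 < T) (hLf : 0 < Lf) (hf : lipschitz_in_v f T Lf) :
  (forall (N : nat) (t v vbar eps : nat -> R),
     is_grid T N t ->
     (forall n, (2 <= n <= N)%N -> bdf2 t v n = f (t n) (v n)) ->
     (forall n, (2 <= n <= N)%N ->
        bdf2 t vbar n = f (t n) (vbar n) + eps n) ->
     let vt := fun i => vbar i - v i in
     (forall i, (2 <= i <= N)%N ->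
        bdf2 t vt i = f (t i) (vbar i) - f (t i) (v i) + eps i) /\
     (max_step N t <= 1 / (4 * Lf) ->
      forall n, (2 <= n <= N)%N ->
        `|vt n| <= 2 * expR (4 * Lf * t n.-1) *
          (`|vt 1%N| + 2 * max_step N t * `|dtau t vt 1|
           + 2 * t n * \big[Num.max/0]_(2 <= i < n.+1) `|eps i|))) /\
  stable 2 (@bdf2 R) f T (fun _ _ => True).
Proof.
split; last exact: bdf2_stable hf.
move=> N t v vbar eps grid_t vP vbarP vt.
have vtP i : (2 <= i <= N)%N ->
    bdf2 t vt i = f (t i) (vbar i) - f (t i) (v i) + eps i.
  by move=> iN; rewrite bdf2B vP// vbarP// addrAC.
split=> // tau_le.
apply: (bdf2_perturbation_estimate (ltW hLf) hf grid_t) => //.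
  exact: step_le_max_step.
move: tau_le; rewrite ler_pdivlMr ?mulr_gt0//; lra.
Qed.
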